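(* Let $\Omega=(a,b)\subset\mathbb{R}$ be a finite interval, $0<\alpha<1$ and $1\le p<\infty$. Then $W_0^{1,p}(\Omega)\subset{}^{\pm}W^{\alpha,p}(\Omega)$ for each choice of sign. Hence $W_0^{1,p}(\Omega)\subset W^{\alpha,p}(\Omega)$.
   Context: Fractional integrals on $(a,b)$, for $\sigma>0$: ${}^{-}I^{\sigma}f(x)=\frac{1}{\Gamma(\sigma)}\int_a^x\frac{f(y)}{(x-y)^{1-\sigma}}\,dy$ and ${}^{+}I^{\sigma}f(x)=\frac{1}{\Gamma(\sigma)}\int_x^b\frac{f(y)}{(y-x)^{1-\sigma}}\,dy$. For $0<\alpha<1$: ${}^{-}D^{\alpha}\varphi=\frac{d}{dx}\,{}^{-}I^{1-\alpha}\varphi$ and ${}^{+}D^{\alpha}\varphi=-\frac{d}{dx}\,{}^{+}I^{1-\alpha}\varphi$. Weak fractional derivatives ($0<\alpha<1$): for $u\in L^1(\Omega)$, $v\in L^1_{loc}(\Omega)$ is the left (resp. right) weak fractional derivative of $u$, written ${}^{-}\mathcal{D}^{\alpha}u=v$ (resp. ${}^{+}\mathcal{D}^{\alpha}u=v$), if $\int_\Omega v\varphi\,dx=\int_\Omega u\,{}^{+}D^{\alpha}\varphi\,dx$ (resp. with ${}^{-}D^{\alpha}\varphi$ on the right-hand side) for all $\varphi\in C_0^\infty(\Omega)$. ${}^{\pm}W^{\alpha,p}(\Omega)=\{u\in L^p(\Omega):{}^{\pm}\mathcal{D}^{\alpha}u\in L^p(\Omega)\}$ and $W^{\alpha,p}(\Omega)={}^{-}W^{\alpha,p}(\Omega)\cap{}^{+}W^{\alpha,p}(\Omega)$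 (for $0<\alpha<1$). $W_0^{1,p}(\Omega)$ is the usual integer order Sobolev space, the closure of $C_0^\infty(\Omega)$ in $W^{1,p}(\Omega)$. *)

(* Defs.v *)
From HB Require Import structures.
From mathcomp Require Import all_boot all_order all_algebra.
From mathcomp Require Import all_classical all_reals all_analysis.
Import Order.TTheory GRing.Theory Num.Theory.
Import numFieldNormedType.Exports.

Set Implicit Arguments.
Unset Strict Implicit.
Unset Printing Implicit Defensive.

Local Open Scope classical_set_scope.
Local Open Scope ring_scope.

(* Functions on Omega = ]a, b[ are represented by functions R -> R, of which
   only the values on ]a, b[ matter.  A subspace of L^p is the set of all
   representatives of its elements, so it is closed under equality a.e. on
   ]a, b[. *)

Section FractionalSobolev.
Context {R : realType}.
Implicit Types (a b s alpha p x : R) (f u v w phi : R -> R).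

Local Notation mu := (@lebesgue_measure R).

Definition Gamma s : R :=
  \int[mu]_(t in `]0, +oo[) (t `^ (s - 1) * expR (- t)).

Definition fracI_left a s f x : R :=
  (Gamma s)^-1 * \int[mu]_(y in `]a, x[) (f y / (x - y) `^ (1 - s)).

Definition fracI_right b s f x : R :=
  (Gamma s)^-1 * \int[mu]_(y in `]x, b[) (f y / (y - x) `^ (1 - s)).

Definition fracD_left a alpha phi x : R :=
  derive1 (fracI_left a (1 - alpha) phi) x.

Definition fracD_right b alpha phi x : R :=
  - derive1 (fracI_right b (1 - alpha) phi) x.

(* C_0^oo(]a, b[), each function being extended by zero to R *)
Definition test_function a b phi : Prop :=
  [/\ forall n x, derivable (derive1n n phi) x 1,
      compact (closure [set x | phi x != 0]) &
      closure [set x | phi x != 0] `<=` `]a, b[].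

(* Lnorm integrates over all of R, hence the restriction to ]a, b[ *)
Definition normLp a b p f : \bar R :=
  Lnorm mu p%:E (EFin \o (f \_ `]a, b[)).

Definition Lp_space a b p : set (R -> R) :=
  [set f | f \_ `]a, b[ \in Lfun mu p%:E].

Definition L1_loc a b : set (R -> R) :=
  [set f | locally_integrable `]a, b[ f].

Definition is_weak_fracD_left a b alpha u v : Prop :=
  [/\ Lp_space a b 1 u, L1_loc a b v &
      forall phi, test_function a b phi ->
        \int[mu]_(x in `]a, b[) (v x * phi x) =
        \int[mu]_(x in `]a, b[) (u x * fracD_right b alpha phi x)].

Definition is_weak_fracD_right a b alpha u v : Prop :=
  [/\ Lp_space a b 1 u, L1_loc a b v &
      forall phi, test_function a b phi ->
        \int[mu]_(x in `]a, b[) (v x * phi x) =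
        \int[mu]_(x in `]a, b[) (u x * fracD_left a alpha phi x)].

Definition W_left a b alpha p : set (R -> R) :=
  [set u | Lp_space a b p u /\
     exists2 v, is_weak_fracD_left a b alpha u v & Lp_space a b p v].

Definition W_right a b alpha p : set (R -> R) :=
  [set u | Lp_space a b p u /\
     exists2 v, is_weak_fracD_right a b alpha u v & Lp_space a b p v].

Definition W_frac a b alpha p : set (R -> R) :=
  W_left a b alpha p `&` W_right a b alpha p.

Definition is_weak_derivative a b u v : Prop :=
  [/\ L1_loc a b u, L1_loc a b v &
      forall phi, test_function a b phi ->
        \int[mu]_(x in `]a, b[) (v x * phi x) =
        - \int[mu]_(x in `]a, b[) (u x * derive1 phi x)].

Definition W1p a b p : set (R -> R) :=
  [set u | Lp_space a b p u /\
     exists2 v, is_weak_derivative a b u v & Lp_space a b p v].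

(* the norm of u in W^{1,p} when v is a weak derivative of u *)
Definition normW1p a b p u v : \bar R :=
  ((normLp a b p u `^ p + normLp a b p v `^ p) `^ p^-1)%E.

(* closure of C_0^oo in W^{1,p}: u is at W^{1,p}-distance less than any e > 0
   from some test function *)
Definition W01p a b p : set (R -> R) :=
  [set u | W1p a b p u /\
     forall e : R, 0 < e -> exists phi w,
       [/\ test_function a b phi, is_weak_derivative a b (u \- phi) w &
           (normW1p a b p (u \- phi)%R w < e%:E)%E]].

End FractionalSobolev.

(* Main.v *)
(** Up to a constant, the one-sided fractional integrals of order
    [1 - alpha] on [(a, b)] are convolutions with the integrable kernel
    [t^-alpha 1_(0, b - a)], and the left and right ones are transposes of each
    other.  For [u] in [W_0^{1,p}] with weak derivative [u'], the candidate weak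
    fractional derivatives are [I^{1-alpha} u'] (up to sign).  They lie in [L^p]
    by Young's inequality.  For a test function [phi], Fubini turns
    [int (I^{1-alpha} u') phi] into [int u' g], where [g], the transposed
    fractional integral of [phi], is smooth on the whole line but does not vanish
    at both endpoints.  The integration by parts [int u' g = - int u g'] is where
    membership in the closure of the test functions is used: it is clear for test
    functions, and it passes to the limit once one knows that two weak
    derivatives agree against [g], which follows by multiplying [g] by smooth
    cutoffs that converge to 1 on [(a, b)]. *)
Require Import Defs.
From mathcomp Require Import all_boot all_order all_algebra.
From mathcomp Require Import all_classical all_reals all_analysis.
From mathcomp Require Import measurable_realfun lebesgue_integral_under ring lra.
Import Order.TTheory GRing.Theory Num.Theory.
Import numFieldNormedType.Exports.

Local Open Scope classical_set_scope.
Local Open Scope ring_scope.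

(** * A weighted power inequality *)

(** For [t > m] the ratio [t / m] exceeds 1, so it is at most its [p]-th power. This splitting at
    level [m] stands in for Young's inequality and involves no conjugate exponent, so [p = 1] is
    covered uniformly. *)
Lemma le_add_powR (R : realType) (p m t : R) : 1 <= p -> 0 < m -> 0 <= t ->
  t <= m + m `^ (1 - p) * t `^ p.
Proof.
move=> p1 m0 t0; have [tm|/ltW mt] := leP t m.
  by rewrite (le_trans tm)// lerDl mulr_ge0// powR_ge0.
apply: (@le_trans _ _ (m `^ (1 - p) * t `^ p)); last by rewrite lerDr ltW.
have h : t / m <= (t / m) `^ p by rewrite le1r_powR// ler_pdivlMr// mul1r.
have E : m `^ (1 - p) = m * m^-1 `^ p.
  rewrite powRD; last by rewrite (gt_eqF m0) implybT.
  by rewrite powRr1 ?(ltW m0)// -[in RHS]powR_inv1 ?(ltW m0)// -powRrM mulN1r.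
rewrite E -mulrA -powRM ?invr_ge0 ?(ltW m0)// mulrC -ler_pdivrMr//.
by rewrite [m^-1 * t]mulrC.
Qed.

Section weighted_power.
Local Open Scope ereal_scope.
Context d (T : measurableType d) (R : realType) (mu : {measure set T -> \bar R}).

(* Integrating [le_add_powR] and taking [m ^ p] close to the integral of
   [w * f ^ p] gives Jensen's inequality up to a constant, without Hoelder. *)
Lemma poweR_weighted_integral_le (p M : R) (w f : T -> R) :
  (1 <= p)%R -> (0 <= M)%R ->
  (forall x, 0 <= w x)%R -> (forall x, 0 <= f x)%R ->
  measurable_fun setT w -> measurable_fun setT f ->
  \int[mu]_x (w x)%:E <= M%:E ->
  (\int[mu]_x (w x * f x)%:E) `^ p <=
    ((M + 1) `^ p)%:E * \int[mu]_x (w x * f x `^ p)%:E.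
Proof.
move=> p1 M0 w0 f0 mw mf wM.
have p0 : (0 < p)%R by exact: lt_le_trans p1.
have c0 : (0 < (M + 1) `^ p)%R by rewrite powR_gt0// ltr_wpDl.
have mfp : measurable_fun setT (fun x => f x `^ p)%R.
  exact: (measurableT_comp (measurable_powR _)).
set A := \int[mu]_x _; set B := (X in _ <= _ * X).
have A0 : 0 <= A by apply: integral_ge0 => x _; rewrite lee_fin mulr_ge0.
have B0 : 0 <= B.
  by apply: integral_ge0 => x _; rewrite lee_fin mulr_ge0// powR_ge0.
have mwf : measurable_fun setT (fun x => (w x * f x)%:E).
  by apply/measurable_EFinP; exact: measurable_funM.
have mwfp c : measurable_fun setT (fun x => (c * (w x * f x `^ p))%:E).
  by apply/measurable_EFinP; do 2 apply: measurable_funM => //.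
have mcw c : measurable_fun setT (fun x => (c * w x)%:E).
  by apply/measurable_EFinP; exact: measurable_funM.
have AB m : (0 < m)%R -> A <= (m * M)%:E + (m `^ (1 - p))%:E * B.
  move=> m0.
  have -> : (m `^ (1 - p))%:E * B =
      \int[mu]_x (m `^ (1 - p) * (w x * f x `^ p))%:E.
    under eq_integral do rewrite EFinM.
    rewrite ge0_integralZl_EFin ?powR_ge0//.
    - by move=> x _; rewrite lee_fin mulr_ge0// powR_ge0.
    - by apply/measurable_EFinP; exact: measurable_funM.
  apply: (@le_trans _ _ (\int[mu]_x (m * w x)%:E +
      \int[mu]_x (m `^ (1 - p) * (w x * f x `^ p))%:E)); last first.
    rewrite leeD2r//; under eq_integral do rewrite EFinM.
    rewrite ge0_integralZl_EFin ?(ltW m0)//; last 2 first.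
    - by move=> x _; rewrite lee_fin.
    - exact/measurable_EFinP.
    by rewrite EFinM lee_wpmul2l// lee_fin ltW.
  rewrite -ge0_integralD//.
  2: by move=> x _; rewrite lee_fin mulr_ge0// ltW.
  2: by move=> x _; rewrite lee_fin !mulr_ge0// powR_ge0.
  apply: ge0_le_integral => //.
  - by move=> x _; rewrite lee_fin mulr_ge0.
  - exact: emeasurable_funD.
  move=> x _; rewrite -EFinD lee_fin.
  by rewrite mulrCA [(m * _)%R]mulrC -mulrDr ler_wpM2l// le_add_powR.
have [->|Boo] := eqVneq B +oo; first by rewrite gt0_muley ?lte_fin// leey.
have [r Br] : exists r, B = r%:E.
  exists (fine B); rewrite fineK// ge0_fin_numE//.
  by rewrite lt_neqAle Boo leey.
have r0 : (0 <= r)%R by rewrite -lee_fin -Br.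
apply/lee_addgt0Pr => e e0.
(* [e'] is [e] divided by the final constant, so the error ends up being exactly [e]; adding it to
   [r] also keeps [m] positive when [r = 0]. Since [m] is the [p]-th root of [r + e'], the second
   term of [AB] is at most [m]. *)
pose e' := (e / (M + 1) `^ p)%R.
have e'0 : (0 < e')%R by rewrite divr_gt0.
have re0 : (0 < r + e')%R by rewrite ltr_wpDl.
pose m := ((r + e') `^ p^-1)%R.
have m0 : (0 < m)%R by rewrite powR_gt0.
have mp : (m `^ p = r + e')%R by rewrite -powRrM mulVf ?gt_eqF// powRr1// ltW.
have Am : A <= (m * (M + 1))%:E.
  apply: le_trans (AB _ m0) _.
  rewrite Br -EFinM -EFinD lee_fin mulrDr lerD2l mulr1.
  apply: (@le_trans _ _ (m `^ (1 - p) * m `^ p)%R).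
    by rewrite ler_wpM2l ?powR_ge0// mp lerDl ltW.
  rewrite -powRD; last by rewrite (gt_eqF m0) implybT.
  by rewrite subrK powRr1// ltW.
apply: (@le_trans _ _ ((m * (M + 1))%:E `^ p)).
  apply: gt0_ler_poweR => //; first exact: ltW.
  - by rewrite in_itv/= A0 leey.
  - by rewrite in_itv/= leey andbT lee_fin mulr_ge0 ?addr_ge0// ltW.
rewrite poweR_EFin powRM ?addr_ge0//; last exact: ltW.
rewrite mp Br -EFinM -EFinD lee_fin mulrDl mulrC lerD2l.
by rewrite /e' divfK// gt_eqF.
Qed.

End weighted_power.

(** * Convolution with an integrable kernel *)

Section affine_change_of_variable.
Context {R : realType}.
Local Notation mu := (@lebesgue_measure R).

Lemma measurable_affine (e x : R) : measurable_fun setT (fun t : R => x + e * t).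
Proof. by apply: measurable_funD => //; exact: measurable_funM. Qed.

(** By uniqueness it is enough to compare the measures on intervals []a, b]]. Their preimages are
    half-open intervals of the same length; for [e = -1] the closed end moves to the left. *)
Lemma lebesgue_measure_affine (e x : R) (A : set R) :
  e = 1 \/ e = -1 -> measurable A ->
  pushforward mu (fun t : measurableTypeR R => x + e * t : measurableTypeR R) A = mu A.
Proof.
move=> he mA; apply/esym.
apply: (@lebesgue_measure_unique R
  (pushforward mu (fun t : measurableTypeR R => x + e * t : measurableTypeR R))
  _ A mA).
  exact: measurable_affine.
move=> mphi _ [[a b] _ <-]; change (mu `]a, b] = mu ((fun t : R => x + e * t) @^-1` `]a, b]))%classic.
clear mphi.
case: he => ->.
  rewrite (_ : _ @^-1` _ = `]a - x, b - x]%classic); last first.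
    apply/seteqP; split => t /=; rewrite !in_itv/= => /andP[h1 h2];
      apply/andP; split; lra.
  rewrite !lebesgue_measure_itv/= !lte_fin ltrD2r.
  by case: ifPn => // _; congr EFin; lra.
rewrite (_ : _ @^-1` _ = `[x - b, x - a[%classic); last first.
  apply/seteqP; split => t /=; rewrite !in_itv/= => /andP[h1 h2];
      apply/andP; split; lra.
rewrite !lebesgue_measure_itv/= !lte_fin ltrD2l ltrN2.
by case: ifPn => // _; congr EFin; lra.
Qed.

Lemma ge0_integral_affine (e x : R) (f : R -> \bar R) :
  e = 1 \/ e = -1 -> measurable_fun setT f -> (forall t, 0 <= f t)%E ->
  (\int[mu]_t f (x + e * t)%R = \int[mu]_t f t)%E.
Proof.
move=> he mf f0.
pose phi := fun t : measurableTypeR R => x + e * t : measurableTypeR R.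
transitivity (\int[pushforward mu phi]_t f t)%E.
  rewrite (@ge0_integral_pushforward _ _ _ _ _ phi)//.
  exact: measurable_affine.
apply: eq_measure_integral; first exact: measurable_affine.
by move=> mphi A mA _; exact: lebesgue_measure_affine.
Qed.

(** The integral is the difference of those of the positive and negative parts, and each is
    transported separately, so divergent integrals are covered too. *)
Lemma integral_affine (e x : R) (f : R -> \bar R) :
  e = 1 \/ e = -1 -> measurable_fun setT f ->
  (\int[mu]_t f (x + e * t)%R = \int[mu]_t f t)%E.
Proof.
move=> he mf; pose phi (t : R) := x + e * t.
rewrite -[LHS]/(\int[mu]_t (f \o phi) t)%E integralE [RHS]integralE.
rewrite funepos_comp funeneg_comp.
by rewrite -(ge0_integral_affine e x _ he (measurable_funepos mf))//
  -(ge0_integral_affine e x _ he (measurable_funeneg mf)).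
Qed.

End affine_change_of_variable.

(** * The truncated Riesz kernel *)

Section kernel.
Context {R : realType}.
Variables (alpha L : R).
Local Notation mu := (@lebesgue_measure R).

(** Vanishing on [t <= 0] makes the convolution one-sided. Truncation at [L] makes the kernel
    integrable on the line, and for [L = b - a] it changes nothing between points of []a, b[]. *)
Definition riesz_kernel : R -> R := (fun t => (t `^ alpha)^-1) \_ `]0, L[.

Lemma riesz_kernel_ge0 t : 0 <= riesz_kernel t.
Proof. by rewrite /riesz_kernel patchE; case: ifPn => // _; rewrite invr_ge0 powR_ge0. Qed.

Lemma measurable_riesz_kernel : measurable_fun setT riesz_kernel.
Proof.
apply/(measurable_restrictT (D := `]0, L[%classic)) => //.
apply: (eq_measurable_fun (fun t => t `^ (- alpha))).
  by move=> t _; rewrite powRN.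
exact: measurable_funTS (measurable_powR _).
Qed.

(** The integrals over the intervals [F n] increase to that over []0, L[], and the primitive [P],
    that is [t^(1 - alpha) / (1 - alpha)], bounds them uniformly in [n]. *)
Lemma integrable_riesz_kernel : alpha < 1 -> mu.-integrable setT (EFin \o riesz_kernel).
Proof.
move=> al1.
have al0 : 0 < 1 - alpha by rewrite subr_gt0.
apply/integrableP; split.
  by apply/measurable_EFinP; exact: measurable_riesz_kernel.
under eq_integral do rewrite /= ger0_norm ?riesz_kernel_ge0//.
rewrite /riesz_kernel.
rewrite (_ : \int[mu]_x _ = \int[mu]_(t in `]0%R, L[) (t `^ (- alpha))%:E)%E; last first.
  rewrite [RHS]integral_mkcond; apply: eq_integral => t _; rewrite !patchE.
  by case: ifPn => //; rewrite powRN.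
pose F n : set R := `[n.+1%:R^-1, L[%classic.
have mF n : measurable (F n) by exact: measurable_itv.
have mf n : measurable_fun (F n) (fun t => (t `^ (- alpha))%:E).
  by apply/measurable_EFinP; exact: measurable_funTS (measurable_powR _).
have FE : \bigcup_n F n = `]0, L[%classic.
  apply/seteqP; split => t.
    move=> [n _]; rewrite /F/= !in_itv/= => /andP[nt ->]; rewrite andbT.
    by rewrite (lt_le_trans _ nt)// invr_gt0.
  rewrite /= in_itv/= => /andP[t0 tL].
  exists (Num.truncn t^-1) => //; rewrite /F/= in_itv/= tL andbT.
  rewrite invf_ple ?posrE//; apply: ltW; exact: truncnS_gt.
have nF : nondecreasing_seq F.
  move=> m n mn; apply/subsetPset => t; rewrite /F/= !in_itv/= => /andP[h ->].
  by rewrite andbT (le_trans _ h)// lef_pV2 ?posrE// ler_nat.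
have := @ge0_nondecreasing_set_cvg_integral _ (measurableTypeR R) R F (fun t => (t `^ (- alpha))%:E)
   mu nF mF mf (fun i x _ => ltac:(by rewrite lee_fin powR_ge0)).
rewrite FE => /cvg_lim <- //.
apply: (@le_lt_trans _ _ (L `^ (1 - alpha) / (1 - alpha))%:E); last exact: ltry.
apply: lime_le.
  apply: ereal_nondecreasing_is_cvgn.
  by apply: ge0_nondecreasing_set_nondecreasing_integral => // i x _; rewrite lee_fin powR_ge0.
(* For small [n] the interval [F n] may be empty, and its integral is then zero. *)
apply: nearW => n; have [Ln|nL] := leP L n.+1%:R^-1.
  rewrite /F set_itv_ge ?integral_set0 ?lee_fin ?divr_ge0 ?powR_ge0 ?(ltW al0)//.
  by rewrite -leNgt bnd_simp.
have n0 : 0 < n.+1%:R^-1 :> R by rewrite invr_gt0.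
rewrite /F integral_itv_bndo_bndc; last exact: mf.
pose P : R -> R := (1 - alpha)^-1 *: (fun s : R => s `^ (1 - alpha)).
have dP (t : R) : 0 < t -> is_derive t 1 P (t `^ (- alpha)).
  move=> t0; have h : is_derive t 1 (fun s : R => s `^ (1 - alpha))
      ((1 - alpha) * t `^ (1 - alpha - 1)) by exact: is_derive1_powR.
  apply: is_derive_eq; rewrite /GRing.scale/= mulKf ?gt_eqF//.
  by congr (_ `^ _); lra.
have cP (t : R) : 0 < t -> {for t, continuous P}.
  move=> t0; apply: differentiable_continuous; apply/derivable1_diffP.
  by case: (dP _ t0).
rewrite (@continuous_FTC2 _ _ P)//.
- rewrite -EFinB lee_fin /P /= /GRing.scale/= mulrC lerBlDr lerDl.
  by rewrite mulr_ge0 ?powR_ge0// invr_ge0 ltW.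
- apply: derivable_within_continuous => t; rewrite in_itv/= => /andP[h _].
  by apply: derivable_powR; rewrite in_itv/= andbT (lt_le_trans n0).
- split.
  + move=> t; rewrite in_itv/= => /andP[h _].
    by case: (dP _ (lt_trans n0 h)).
  + exact/cvg_at_right_filter/cP.
  + exact/cvg_at_left_filter/cP/(lt_trans n0).
- move=> t; rewrite in_itv/= => /andP[h _].
  have h2 := dP _ (lt_trans n0 h).
  by rewrite derive1E derive_val.
Qed.

End kernel.

(** * Transposition and Young's inequality for one-sided convolutions *)

Section convolution.
Context {R : realType}.
Local Notation mu := (@lebesgue_measure R).
Variable k : R -> R.
Hypothesis k_ge0 : forall t, 0 <= k t.
Hypothesis mk : measurable_fun setT k.
Hypothesis ik : mu.-integrable setT (EFin \o k).

(** For a kernel carried by the positive half-line, [e = 1] integrates over [y > x] and [e = -1]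
    over [y < x], so that one proof serves both fractional integrals. *)
Definition convol (e : R) (f : R -> R) (x : R) : R :=
  \int[mu]_y (k (e * (y - x)) * f y).

Let M := \int[mu]_t k t.

Let M_ge0 : 0 <= M. Proof. exact: Rintegral_ge0. Qed.

Let int_k : (\int[mu]_t (k t)%:E = M%:E)%E.
Proof. by rewrite /M /Rintegral fineK//; exact: integrable_fin_num. Qed.

Let mk2 (e : R) : measurable_fun setT
  (fun z : measurableTypeR R * measurableTypeR R => k (e * (z.2 - z.1))).
Proof.
apply: measurableT_comp => //; apply: measurable_funM => //.
by apply: measurable_funB; [exact: measurable_snd|exact: measurable_fst].
Qed.

Let mkl (e x : R) : measurable_fun setT (fun y : R => k (e * (y - x))).
Proof. by apply: measurableT_comp => //; apply: measurable_funM => //; exact: measurable_funB. Qed.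

Let mkr (e y : R) : measurable_fun setT (fun x : R => k (e * (y - x))).
Proof. by apply: measurableT_comp => //; apply: measurable_funM => //; exact: measurable_funB. Qed.

Let int_kl (e x : R) : e = 1 \/ e = -1 -> (\int[mu]_y (k (e * (y - x)))%:E = M%:E)%E.
Proof.
move=> he; rewrite -int_k -(integral_affine e (- (e * x)) (EFin \o k) he) /=.
  by apply: eq_integral => y _; do 2 congr (_ _); rewrite mulrBr addrC.
exact/measurable_EFinP.
Qed.

Let int_kr (e y : R) : e = 1 \/ e = -1 -> (\int[mu]_x (k (e * (y - x)))%:E = M%:E)%E.
Proof.
move=> he; have he' : - e = 1 \/ - e = -1 by case: he => ->; rewrite ?opprK; [right|left].
rewrite -int_k -(integral_affine (- e) (e * y) (EFin \o k) he') /=.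
  by apply: eq_integral => x _; do 2 congr (_ _); rewrite mulrBr mulNr.
exact/measurable_EFinP.
Qed.

Section convolution_lemmas.
Variables (e : R) (f : R -> R).
Hypothesis he : e = 1 \/ e = -1.
Hypothesis fi : mu.-integrable setT (EFin \o f).

Let mf : measurable_fun setT f.
Proof. by move/integrableP : fi => [/measurable_EFinP]. Qed.

Let F (z : measurableTypeR R * measurableTypeR R) : \bar R :=
  (k (e * (z.2 - z.1)) * f z.2)%:E.

Let mF : measurable_fun setT F.
Proof.
apply/measurable_EFinP; apply: measurable_funM; first exact: mk2.
by apply: measurableT_comp => //; exact: measurable_snd.
Qed.

(** By Tonelli, integrating in the first variable first leaves [M * |f y|]. Joint integrability
    gives access to Fubini and to the measurability of the convolution. *)
Let iF : (mu \x mu)%E.-integrable setT F.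
Proof.
apply/integrable21ltyP => //.
apply: (@le_lt_trans _ _ (\int[mu]_y (M * `|f y|)%:E)%E).
  apply: ge0_le_integral => //.
  - by move=> y _; exact: integral_ge0.
  - apply: (@measurable_fun_fubini_tonelli_G _ _ _ _ _ mu (abse \o F)).
      exact: measurableT_comp.
    by move=> z; exact: abse_ge0.
  - by apply/measurable_EFinP; apply: measurable_funM => //; exact: measurableT_comp.
  move=> y _.
  rewrite [leLHS](_ : _ = (\int[mu]_x (`|f y|%:E * (k (e * (y - x)))%:E))%E); last first.
    by apply: eq_integral => x _; rewrite /F /= normrM (ger0_norm (k_ge0 _)) -EFinM mulrC.
  rewrite ge0_integralZl_EFin//.
  - by rewrite int_kr// -EFinM mulrC.
  - by move=> x _; rewrite lee_fin.
  - by apply/measurable_EFinP; exact: mkr.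
under eq_integral do rewrite EFinM.
rewrite ge0_integralZl_EFin//; last by apply/measurable_EFinP; exact: measurableT_comp.
by move/integrableP : fi => [_ fi']; rewrite lte_mul_pinfty ?lee_fin.
Qed.

Let convol_fubini : convol e f = fine \o fubini_F mu F.
Proof. by []. Qed.

Lemma measurable_convol : measurable_fun setT (convol e f).
Proof.
rewrite convol_fubini; apply: (measurableT_comp (fine_measurable measurableT)).
exact: (measurable_fubini_F iF).
Qed.

Lemma integrable_convol : mu.-integrable setT (EFin \o convol e f).
Proof.
apply: (le_integrable _ _ _ (integrable_fubini_F iF)) => //.
  by apply/measurable_EFinP; exact: measurable_convol.
move=> x _; rewrite convol_fubini/=.
(* [fine] sends infinite values to 0, so it can only decrease the absolute value. *)
by case: (fubini_F _ _ _) => [r| |] //=; rewrite normr0 leey.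
Qed.

Lemma integrable_kernel_mul (g : R -> R) (C y : R) :
  measurable_fun setT g -> (forall x, `|g x| <= C) ->
  mu.-integrable setT (EFin \o (fun x => k (e * (y - x)) * g x)).
Proof.
move=> mg gC.
have C0 : 0 <= C by exact: le_trans (gC 0).
apply/integrableP; split.
  by apply/measurable_EFinP; apply: measurable_funM => //; exact: mkr.
apply: (@le_lt_trans _ _ (\int[mu]_x (C * k (e * (y - x)))%:E)%E).
  apply: ge0_le_integral => //.
  - apply/measurable_EFinP; apply: measurableT_comp => //.
    by apply: measurable_funM => //; exact: mkr.
  - by apply/measurable_EFinP; apply: measurable_funM => //; exact: mkr.
  by move=> x _; rewrite lee_fin /= normrM (ger0_norm (k_ge0 _)) mulrC ler_wpM2r.
under eq_integral do rewrite EFinM.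
rewrite ge0_integralZl_EFin//.
- by rewrite int_kr// -EFinM ltry.
- by move=> x _; rewrite lee_fin.
- by apply/measurable_EFinP; exact: mkr.
Qed.

(** Fubini, together with [e * (y - x) = - e * (x - y)]: exchanging the variables flips the sign.
    This is the duality between the left and right fractional integrals. *)
Lemma integral_convol_mul (g : R -> R) (C : R) :
  measurable_fun setT g -> (forall x, `|g x| <= C) ->
  \int[mu]_x (convol e f x * g x) = \int[mu]_y (f y * convol (- e) g y).
Proof.
move=> mg gC; rewrite /Rintegral; congr fine.
pose G (z : measurableTypeR R * measurableTypeR R) : \bar R :=
  (k (e * (z.2 - z.1)) * f z.2 * g z.1)%:E.
have iG : (mu \x mu)%E.-integrable setT G.
  apply: (le_integrable _ _ _ (integrableZl measurableT C iF)) => //.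
    apply/measurable_EFinP; apply: measurable_funM; first exact/measurable_EFinP.
    by apply: measurableT_comp => //; exact: measurable_fst.
  move=> z _; rewrite /F/= lee_fin mulrC !normrM ler_wpM2r//.
  by rewrite (le_trans (gC _))// ler_norm.
transitivity (\int[mu]_x \int[mu]_y G (x, y))%E.
  (* The inner integral is known to converge only for almost every [x], so [fine] can be removed
     only almost everywhere. *)
  apply: ae_eq_integral => //.
  - by apply/measurable_EFinP; apply: measurable_funM => //; exact: measurable_convol.
  - exact: (measurable_fubini_F iG).
  refine (@filterS _ _ (@ae_filter_ringOfSetsType _ (measurableTypeR R) R mu) _ _ _
    (ae_integrable1 iF)) => x ix _ /=.
  rewrite EFinM /convol /Rintegral fineK; last exact: (integrable_fin_num _ ix).
  by rewrite -integralZr.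
rewrite (Fubini iG).
apply: eq_integral => y _.
rewrite EFinM /convol /Rintegral.
(* On this side the bound on [g] makes the inner integral finite for every [y]. *)
have h := @integrable_kernel_mul g C y mg gC.
have -> : (\int[mu]_x (k (- e * (x - y)) * g x)%:E = \int[mu]_x (k (e * (y - x)) * g x)%:E)%E.
  by apply: eq_integral => x _; do 3 congr (_ _); rewrite mulNr -mulrN opprB.
rewrite fineK; last exact: integrable_fin_num.
rewrite -integralZl//; apply: eq_integral => x _.
by rewrite /G/= -EFinM mulrA [f y * _]mulrC.
Qed.

(** Young's inequality for an integrable kernel, in qualitative form: the weighted power inequality
    is applied at each [x], and Tonelli then integrates the kernel out in [x]. *)
Lemma convol_powR_lty (p : R) : 1 <= p ->
  (\int[mu]_x (`|f x| `^ p)%:E < +oo)%E ->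
  (\int[mu]_x (`|convol e f x| `^ p)%:E < +oo)%E.
Proof.
move=> p1 fp.
have mfp : measurable_fun setT (fun x => `|f x| `^ p).
  by apply: (measurableT_comp (measurable_powR _)); exact: measurableT_comp.
pose H (z : measurableTypeR R * measurableTypeR R) : \bar R :=
  (k (e * (z.2 - z.1)) * `|f z.2| `^ p)%:E.
have mH : measurable_fun setT H.
  apply/measurable_EFinP; apply: measurable_funM; first exact: mk2.
  by apply: (measurableT_comp mfp); exact: measurable_snd.
have H0 z : (0 <= H z)%E by rewrite lee_fin mulr_ge0// powR_ge0.
apply: (@le_lt_trans _ _ (\int[mu]_x (((M + 1) `^ p)%:E * \int[mu]_y H (x, y)))%E).
  apply: ge0_le_integral => //.
  - apply/measurable_EFinP.
    have mc : measurable_fun setT (fun x => `|convol e f x|).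
      by apply: measurableT_comp => //; exact: measurable_convol.
    exact: (measurableT_comp (measurable_powR _) mc).
  - apply: measurable_funeM.
    exact: (@measurable_fun_fubini_tonelli_F _ _ _ _ _ mu H).
  move=> x _; rewrite -poweR_EFin.
  (* The weight [k (e * (y - x))] has mass [M] in [y] whatever [x] is, so the constant does not
     depend on [x]. *)
  apply: (@le_trans _ _ ((\int[mu]_y (k (e * (y - x)) * `|f y|)%:E) `^ p)%E); last first.
    have mnf : measurable_fun setT (fun y => `|f y|) by exact: measurableT_comp.
    rewrite /H/=.
    apply: (@poweR_weighted_integral_le _ _ _ mu p M (fun y => k (e * (y - x))) (fun y => `|f y|)) => //.
      exact: mkl.
    by rewrite int_kl.
  have p0 : 0 <= p by exact: le_trans p1.
  have I0 : (0 <= \int[mu]_y (k (e * (y - x)) * `|f y|)%:E)%E.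
    by apply: integral_ge0 => y _; rewrite lee_fin mulr_ge0.
  apply: gt0_ler_poweR => //.
  - by rewrite in_itv/= leey lee_fin normr_ge0.
  - by rewrite in_itv/= leey I0.
  apply: (@le_trans _ _ (`|\int[mu]_y (k (e * (y - x)) * f y)%:E|)%E).
    by rewrite /convol /Rintegral; case: (\int[mu]_y _)%E => [r| |] //=; rewrite normr0 leey.
  apply: le_trans (le_abse_integral _ _ _) _ => //.
    by apply/measurable_EFinP; apply: measurable_funM => //; exact: mkl.
  rewrite le_eqVlt; apply/orP; left; apply/eqP.
  by apply: eq_integral => y _; rewrite abse_EFin normrM (ger0_norm (k_ge0 _)).
have inner y : (\int[mu]_x H (x, y) = M%:E * (`|f y| `^ p)%:E)%E.
  under eq_integral => x _ do rewrite /H /= mulrC EFinM.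
  rewrite ge0_integralZl ?lee_fin ?powR_ge0//.
  - by rewrite int_kr// muleC.
  - by apply/measurable_EFinP; exact: mkr.
  - by move=> x _; rewrite lee_fin.
rewrite ge0_integralZl ?lee_fin ?powR_ge0//.
- rewrite lte_mul_pinfty ?lee_fin ?powR_ge0// fubini_tonelli//.
  under eq_integral do rewrite inner.
  rewrite ge0_integralZl ?lee_fin//; last exact/measurable_EFinP.
  by rewrite lte_mul_pinfty ?lee_fin.
- exact: (@measurable_fun_fubini_tonelli_F _ _ _ _ _ mu H).
- by move=> x _; exact: integral_ge0.
Qed.

End convolution_lemmas.
End convolution.

(** * Smooth functions and cutoffs *)

Section smooth.
Context {R : realType}.
Implicit Types f g : R -> R.

(** Differentiating first and recursing on the derivative lets the rules for sums, products and
    affine substitutions go by induction on [n]. *)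
Fixpoint smooth_upto (n : nat) f : Prop :=
  if n is m.+1 then (forall x, derivable f x 1) /\ smooth_upto m (derive1 f) else True.

Lemma smooth_uptoP f :
  (forall n x, derivable (derive1n n f) x 1) <-> (forall n, smooth_upto n f).
Proof.
split=> [+ n|+ n].
  elim: n f => [//|n ih] f df /=; split; first exact: (df 0%N).
  by apply: ih => m x; have := df m.+1 x; rewrite derive1Sn.
elim: n f => [|n ih] f sf x; first exact: (sf 1%N).1.
by rewrite derive1Sn; apply: ih => m; exact: (sf m.+1).2.
Qed.

Lemma smooth_upto_is_derive n f g : (forall x : R, is_derive x 1 f (g x)) ->
  smooth_upto n g -> smooth_upto n.+1 f.
Proof.
move=> fg sg /=; split=> [x|]; first by case: (fg x).
suff -> : derive1 f = g by [].
by apply/funext => x; rewrite derive1E; case: (fg x).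
Qed.

Lemma smooth_uptoW n f : smooth_upto n.+1 f -> smooth_upto n f.
Proof. by elim: n f => [//|n ih] f [df sf]; split => //; exact: ih. Qed.

Lemma smooth_upto_is_derive1 n f (x : R) : smooth_upto n.+1 f -> is_derive x 1 f (derive1 f x).
Proof. by case=> df _; rewrite derive1E; exact: derivableP. Qed.

Lemma smooth_uptoD n f g : smooth_upto n f -> smooth_upto n g ->
  smooth_upto n (fun x => f x + g x).
Proof.
elim: n f g => [//|n ih] f g sf sg.
apply: (@smooth_upto_is_derive _ _ (fun x => derive1 f x + derive1 g x)).
  move=> x; have ? := smooth_upto_is_derive1 _ _ x sf.
  by have ? := smooth_upto_is_derive1 _ _ x sg; exact: is_deriveD.
by apply: ih; [exact: sf.2|exact: sg.2].
Qed.

Lemma smooth_uptoM n f g : smooth_upto n f -> smooth_upto n g ->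
  smooth_upto n (fun x => f x * g x).
Proof.
elim: n f g => [//|n ih] f g sf sg.
apply: (@smooth_upto_is_derive _ _ (fun x => f x * derive1 g x + g x * derive1 f x)).
  move=> x; have ? := smooth_upto_is_derive1 _ _ x sf.
  by have ? := smooth_upto_is_derive1 _ _ x sg; exact: is_deriveM.
by apply: smooth_uptoD; apply: ih; [exact: smooth_uptoW|exact: sg.2|exact: smooth_uptoW|exact: sf.2].
Qed.

Lemma smooth_upto_cst n (c : R) : smooth_upto n (cst c).
Proof.
elim: n c => [//|n ih] c.
by apply: (@smooth_upto_is_derive _ _ (cst 0)) => // x; exact: is_derive_cst.
Qed.

Lemma smooth_upto_affine n f (c d : R) : smooth_upto n f ->
  smooth_upto n (fun x => f (c * x + d)).
Proof.
elim: n f => [//|n ih] f sf.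
apply: (@smooth_upto_is_derive _ _ (fun x => derive1 f (c * x + d) * c)); last first.
  by apply: smooth_uptoM; [exact: ih sf.2|exact: smooth_upto_cst].
move=> x; apply: (@is_derive1_comp _ f (fun x => c * x + d)).
  exact: smooth_upto_is_derive1 sf.
apply: is_derive_eq.
by rewrite addr0 /GRing.scale/= mulr1.
Qed.

(* The family is closed under differentiation, which makes its members smooth;
   exp(-1/x) is the case k = 0. *)
Definition flat (k : nat) (x : R) : R :=
  if 0 < x then x^-1 ^+ k * expR (- x^-1) else 0.

(** The bound forces [f 0 = 0], and the difference quotient at 0 is then at most [C * |h|]. *)
Lemma is_derive0_quadratic f (C : R) : (forall x, `|f x| <= C * x ^+ 2) ->
  is_derive (0 : R) 1 f 0.
Proof.
move=> fC.
have f0 : f 0 = 0 by apply/normr0_eq0/eqP; rewrite eq_le normr_ge0 (le_trans (fC 0))// expr0n/= mulr0.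
have cv : h^-1 *: (f (h *: 1 + 0) - f 0) @[h --> 0^'] --> (0 : R).
  apply: norm_cvg0.
  apply: (@squeeze_cvgr _ _ _ _ (cst 0) (fun h => C * `|h|)).
  - near=> h; rewrite normr_ge0/= f0 subr0 addr0 /GRing.scale/= mulr1 normrM normfV.
    have h0 : h != 0 by near: h; exact: nbhs_dnbhs_neq.
    rewrite ler_pdivrMl ?normr_gt0// (le_trans (fC _))//.
    by rewrite [leRHS]mulrCA -expr2 real_normK// num_real.
  - exact: cvg_cst.
  - rewrite -[X in _ --> X](mulr0 C); apply: cvgMr.
    rewrite -[X in _ --> X](normr0 R); apply: cvg_norm.
    by apply: cvg_within_filter; exact: cvg_id.
by split; [apply/cvg_ex; exists 0|apply/cvg_lim].
Unshelve. all: end_near. Qed.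

(** With [y = 1/x], the exponential series gives [exp y >= y^(k+2) / (k+2)!], which absorbs the
    factor [y^k] and leaves [x^2] to spare. *)
Lemma flat_le_quadratic k x : `|flat k x| <= (k.+2)`!%:R * x ^+ 2.
Proof.
rewrite /flat; case: ifPn => [x0|_]; last by rewrite normr0 mulr_ge0// sqr_ge0.
have y0 : 0 < x^-1 by rewrite invr_gt0.
rewrite ger0_norm ?mulr_ge0 ?exprn_ge0 ?expR_ge0 ?(ltW y0)//.
have h := @expR_ge1Dxn _ x^-1 k.+1 (ltW y0).
have {}h : x^-1 ^+ k.+2 / (k.+2)`!%:R <= expR x^-1 by apply: le_trans h; rewrite lerDr.
rewrite ler_pdivrMr ?ltr0n ?fact_gt0// in h.
rewrite expRN ler_pdivrMr ?expR_gt0//.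
have -> : x^-1 ^+ k = x^-1 ^+ k.+2 * x ^+ 2.
  by rewrite -addn2 exprD -mulrA -exprMn mulVf ?gt_eqF// expr1n mulr1.
by rewrite [leRHS]mulrAC ler_wpM2r ?sqr_ge0// mulrC.
Qed.

(** Away from 0 the function agrees locally with 0 or with [P] composed with inversion; at 0 the
    quadratic bound gives derivative 0. *)
Lemma is_derive_flat k (x : R) :
  is_derive x 1 (flat k) (- k%:R * flat k.+1 x + flat k.+2 x).
Proof.
have [x0|x0|->] := ltgtP x 0.
- have -> : - k%:R * flat k.+1 x + flat k.+2 x = 0.
    by rewrite /flat ltNge (ltW x0)/= mulr0 addr0.
  rewrite /flat.
  apply: (@near_eq_is_derive _ _ _ (cst 0)).
  by near=> y; rewrite ltNge ltW//; near: y; exact: lt_nbhsl.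
- have -> : - k%:R * flat k.+1 x + flat k.+2 x =
      - k%:R * (x^-1 ^+ k.+1 * expR (- x^-1)) + x^-1 ^+ k.+2 * expR (- x^-1).
    by rewrite /flat x0.
  rewrite /flat; pose P (y : R) := y ^+ k * expR (- y).
  apply: (@near_eq_is_derive _ _ _ (P \o GRing.inv)).
    by near=> y; rewrite ifT//; near: y; exact: lt_nbhsr.
  have dP (y : R) : is_derive y 1 P (k%:R * y ^+ k.-1 * expR (- y) - y ^+ k * expR (- y)).
    rewrite /P.
    have h1 : is_derive y 1 (fun y : R => y ^+ k) (k%:R * y ^+ k.-1).
      split; first exact: exprn_derivable.
      by rewrite exp_derive /GRing.scale/= mulr1.
    have h2 : is_derive y 1 (fun y : R => expR (- y)) (expR (- y) * -1).
      by apply: (@is_derive1_comp _ expR -%R).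
    apply: (@is_derive_eq _ _ _ _ _ _ _ _ (is_deriveM h1 h2)).
    by rewrite /GRing.scale/=; ring.
  have dV : is_derive x 1 (@GRing.inv R) (- x^-1 ^+ 2).
    have h := @is_deriveV R id x 1 1 (lt0r_neq0 x0) (is_derive_id _ _).
    by apply: (@is_derive_eq _ _ _ _ _ _ _ _ h); rewrite /GRing.scale/= mulr1 exprVn.
  apply: (@is_derive_eq _ _ _ _ _ _ _ _ (is_derive1_comp (dP x^-1) dV)).
  (* The exponent [k.-1] is truncated at 0, so the ring identity is checked apart for [k = 0]. *)
  case: k {P dP} => [|k] /=; first by ring.
  rewrite !exprS; ring.
- have -> : - k%:R * flat k.+1 0 + flat k.+2 0 = 0 by rewrite /flat ltxx mulr0 addr0.
  exact: is_derive0_quadratic (flat_le_quadratic k).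
Unshelve. all: end_near. Qed.

Lemma smooth_flat n k : smooth_upto n (flat k).
Proof.
elim: n k => [//|n ih] k; apply: smooth_upto_is_derive (is_derive_flat k) _.
by apply: smooth_uptoD => //; apply: smooth_uptoM => //; exact: smooth_upto_cst.
Qed.

(** The shift by 1 makes the function vanish within distance [1/(n+1)] of the endpoints. It stays
    below 1 but tends to 1 pointwise on []a, b[], as dominated convergence requires. *)
Definition cutoff (a b : R) (n : nat) (x : R) : R :=
  flat 0 (n.+1%:R * (x - a) - 1) * flat 0 (n.+1%:R * (b - x) - 1).

Lemma smooth_cutoff a b n m : smooth_upto m (cutoff a b n).
Proof.
apply: smooth_uptoM.
  rewrite (_ : (fun x => _) = (fun x => flat 0 (n.+1%:R * x + (- n.+1%:R * a - 1)))).
    exact/smooth_upto_affine/smooth_flat.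
  by apply/funext => x; congr flat; ring.
rewrite (_ : (fun x => _) = (fun x => flat 0 (- n.+1%:R * x + (n.+1%:R * b - 1)))).
  exact/smooth_upto_affine/smooth_flat.
by apply/funext => x; congr flat; ring.
Qed.

Lemma flat0_itv x : 0 <= flat 0 x <= 1.
Proof.
rewrite /flat; case: ifPn => [x0|]; last by rewrite lexx ler01.
by rewrite expr0 mul1r expR_ge0 -expR0 ler_expR lerNl oppr0 invr_ge0 ltW.
Qed.

Lemma cutoff_le1 a b n x : `|cutoff a b n x| <= 1.
Proof.
have /andP[h1 h2] := flat0_itv (n.+1%:R * (x - a) - 1).
have /andP[h3 h4] := flat0_itv (n.+1%:R * (b - x) - 1).
by rewrite ger0_norm ?mulr_ge0// mulr_ile1.
Qed.

Lemma cvg_flat0 (c : R) : 0 < c -> flat 0 (n.+1%:R * c - 1) @[n --> \oo] --> (1 : R).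
Proof.
move=> c0.
have Y : (n.+1%:R * c - 1) @[n --> \oo] --> +oo.
  apply/cvgryPge => A; near=> n.
  rewrite lerBrDr -ler_pdivrMr// (le_trans (ltW (truncnS_gt _)))// ler_nat ltnS.
  by near: n; exact: nbhs_infty_ge.
have Y0 : \forall n \near \oo, 0 < n.+1%:R * c - 1.
  by move/cvgryPgt : Y; apply.
have V : (n.+1%:R * c - 1)^-1 @[n --> \oo] --> (0 : R).
  apply/cvgrVy; first by near=> n; rewrite invr_gt0; near: n; exact: Y0.
  by apply: cvg_trans Y; apply: near_eq_cvg; near=> n; rewrite -[LHS]invrK.
have E : expR (- (n.+1%:R * c - 1)^-1) @[n --> \oo] --> (1 : R).
  rewrite -[X in _ --> X]expR0.
  apply: continuous_cvg; first exact: continuous_expR.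
  by rewrite -[X in _ --> X]oppr0; exact: cvgN.
apply: cvg_trans E; apply: near_eq_cvg; near=> n.
rewrite /flat ifT ?expr0 ?mul1r//.
by near: n; exact: Y0.
Unshelve. all: end_near. Qed.

Lemma cvg_cutoff a b x : a < x -> x < b -> cutoff a b n x @[n --> \oo] --> (1 : R).
Proof.
move=> ax xb; rewrite -[X in _ --> X](mulr1 1).
by apply: cvgM; apply: cvg_flat0; rewrite subr_gt0.
Qed.

Lemma cutoff_neq0 a b n x : cutoff a b n x != 0 ->
  a + n.+1%:R^-1 <= x <= b - n.+1%:R^-1.
Proof.
rewrite mulf_eq0 negb_or /flat => /andP[]; case: ifPn => [h1 _|_]; last by rewrite eqxx.
case: ifPn => [h2 _|_]; last by rewrite eqxx.
have n0 : 0 < n.+1%:R :> R by [].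
rewrite subr_gt0 -(ltr_pdivrMl _ _ n0) mulr1 in h1.
rewrite subr_gt0 -(ltr_pdivrMl _ _ n0) mulr1 in h2.
by rewrite -lerBrDl (ltW h1)/= lerBrDr -lerBrDl ltW.
Qed.

(** The support lies in a closed segment inside []a, b[], which yields compactness and inclusion at
    once, whatever [g] does at the endpoints. *)
Lemma test_function_cutoff a b n g : (forall m, smooth_upto m g) ->
  test_function a b (fun x => g x * cutoff a b n x).
Proof.
move=> sg.
have sub : closure [set x | g x * cutoff a b n x != 0] `<=`
    `[a + n.+1%:R^-1, b - n.+1%:R^-1].
  rewrite (closure_id `[a + n.+1%:R^-1, b - n.+1%:R^-1]).1; last exact: itv_closed.
  apply: closureS => x /=; rewrite mulf_eq0 negb_or => /andP[_ /cutoff_neq0].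
  by rewrite in_itv.
split.
- apply/smooth_uptoP => m; apply: smooth_uptoM => //; exact: smooth_cutoff.
- by apply: subclosed_compact sub; [exact: closed_closure|exact: segment_compact].
- apply: (subset_trans sub) => x /=; rewrite !in_itv/= => /andP[h1 h2].
  have n0 : 0 < n.+1%:R^-1 :> R by rewrite invr_gt0.
  by rewrite (lt_le_trans _ h1) ?ltrDl//= (le_lt_trans h2)// gtrBl.
Qed.

End smooth.

(** * Smooth functions and test functions on a bounded interval *)

Section interval.
Context {R : realType}.
Local Notation mu := (@lebesgue_measure R).
Variables (a b : R).
Hypothesis hab : a < b.
Local Notation D := (`]a, b[%classic : set R).
Implicit Types f g h u v phi : R -> R.

Lemma smooth_upto_continuous n g : smooth_upto n.+1 g -> continuous g.
Proof.
by case=> dg _ x; apply: differentiable_continuous; apply/derivable1_diffP.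
Qed.

Lemma continuous_bounded_itv g : continuous g ->
  exists C : R, forall x, D x -> `|g x| <= C.
Proof.
move=> cg.
have [|c _ hc] := @EVT_max R (fun x => `|g x|) a b (ltW hab).
  apply: continuous_subspaceT => x; apply: continuous_comp; first exact: cg.
  exact: norm_continuous.
exists `|g c| => x /= Dx; apply: hc.
by move: Dx; rewrite !in_itv/= => /andP[/ltW -> /ltW ->].
Qed.

Lemma integrableM_continuous f g : mu.-integrable D (EFin \o f) -> continuous g ->
  mu.-integrable D (EFin \o (fun x => f x * g x)).
Proof.
move=> fi cg; have [C gC] := continuous_bounded_itv g cg.
have mg : measurable_fun D g.
  apply: (measurable_funS measurableT) => //; exact: continuous_measurable_fun.
have bg : [bounded g x | x in D].
  exists C; split; first exact: num_real.
  by move=> x Cx y Dy; rewrite /= (le_trans (gC _ Dy))// ltW.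
exact: (@integrableMl _ _ _ mu D (measurable_itv _) (EFin \o f) g fi mg bg).
Qed.

(** Although [g] may be nonzero at [a] and [b], each product of [g] with a cutoff is a test
    function. Dominated convergence with majorant [C * |f|] passes to the limit, without deducing
    that [f] vanishes almost everywhere. *)
Lemma integral_smooth_eq0 f g : mu.-integrable D (EFin \o f) ->
  (forall phi, test_function a b phi -> \int[mu]_(x in D) (f x * phi x) = 0) ->
  (forall n, smooth_upto n g) -> \int[mu]_(x in D) (f x * g x) = 0.
Proof.
move=> fi f0 sg; have cg := smooth_upto_continuous 0 g (sg 1%N).
have [C gC] := continuous_bounded_itv g cg.
have mf : measurable_fun D f by move/integrableP : fi => [/measurable_EFinP].
pose gn n x := g x * cutoff a b n x.
have sgn n m : smooth_upto m (gn n).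
  by apply: smooth_uptoM => //; exact: smooth_cutoff.
have ign n : mu.-integrable D (EFin \o (fun x => f x * gn n x)).
  by apply: integrableM_continuous => //; exact: smooth_upto_continuous 0 _ (sgn n 1%N).
have ig := integrableM_continuous f g fi cg.
have := @dominated_convergence _ (measurableTypeR R) R mu D (measurable_itv _)
  (fun n x => (f x * gn n x)%:E) (fun x => (f x * g x)%:E) (fun x => (`|f x| * C)%:E).
case.
- by move=> n; exact: (measurable_int _ (ign n)).
- exact: (measurable_int _ ig).
- apply: aeW => x Dx; apply: cvg_EFin; first exact: nearW.
  apply: cvgMr; rewrite -[X in _ --> X]mulr1; apply: cvgMr.
  by move: Dx; rewrite /= in_itv/= => /andP[ax xb]; exact: cvg_cutoff.
- apply: (integrableM_continuous (fun x => `|f x|) (cst C)).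
    exact: integrable_norm.
  exact: cst_continuous.
- apply: aeW => x n Dx; rewrite lee_fin normrM ler_wpM2l// normrM.
  by rewrite -[leRHS]mulr1 ler_pM// ?gC// cutoff_le1.
move=> _ _ cv.
rewrite /Rintegral; suff -> : (\int[mu]_(x in D) (f x * g x)%:E = 0)%E by [].
rewrite -(cvg_lim _ cv)//.
apply/cvg_lim => //.
have Z n : (\int[mu]_(x in D) (f x * gn n x)%:E = 0)%E.
  rewrite -[LHS]fineK; last exact: (integrable_fin_num _ (ign n)).
  by congr EFin; exact: (f0 _ (test_function_cutoff a b n g sg)).
by under eq_fun do rewrite Z; exact: cvg_cst.
Qed.

Lemma test_function_smooth phi : test_function a b phi -> forall n, smooth_upto n phi.
Proof. by case=> /smooth_uptoP. Qed.

Lemma test_function_continuous phi : test_function a b phi -> continuous phi.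
Proof. by move=> tphi; exact: smooth_upto_continuous 0 _ (test_function_smooth _ tphi 1%N). Qed.

Lemma test_function_eq0 phi x : test_function a b phi -> ~ D x -> phi x = 0.
Proof.
case=> _ _ sub; apply: contra_notP => /eqP px; apply: sub.
exact: subset_closure.
Qed.

(** The complement of the support is open and [phi] is zero there, so the derivative also vanishes
    there and its support is no larger. *)
Lemma test_function_derive1 phi : test_function a b phi -> test_function a b (derive1 phi).
Proof.
move=> tphi; have [dphi cphi sub] := tphi.
have sub' : closure [set x | derive1 phi x != 0] `<=` closure [set x | phi x != 0].
  rewrite [X in _ `<=` X](closure_id (closure _)).1; last exact: closed_closure.
  apply: closureS => x /=; apply: contra_neqP => nx.
  rewrite derive1E (@near_eq_derive _ _ _ _ (cst 0)) ?derive_cst ?oner_neq0//.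
  have : nbhs x (~` closure [set x | phi x != 0]).
    by apply: open_nbhs_nbhs; split=> //; exact/closed_openC/closed_closure.
  apply: filterS => y /= ny; apply: contra_notP ny => /eqP py.
  exact: subset_closure.
split.
- by move=> n x; have := dphi n.+1 x; rewrite derive1Sn.
- apply: subclosed_compact sub' => //; exact: closed_closure.
- exact: subset_trans sub.
Qed.

Lemma test_function_bounded phi : test_function a b phi ->
  exists C : R, forall x, `|phi x| <= C.
Proof.
move=> tphi; have [C hC] := continuous_bounded_itv _ (test_function_continuous _ tphi).
exists (Num.max C 0) => x; rewrite le_max.
have [Dx|Dx] := pselect (D x); first by rewrite hC.
by rewrite (test_function_eq0 _ _ tphi Dx) normr0 lexx orbT.
Qed.

(** The boundary terms vanish because [phi] does at both endpoints; [g] is unconstrained there. Two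
    orders of smoothness make the derivative of [g] continuous. *)
Lemma integral_by_parts_test phi g : test_function a b phi -> smooth_upto 2 g ->
  \int[mu]_(x in D) (derive1 phi x * g x) = - \int[mu]_(x in D) (phi x * derive1 g x).
Proof.
move=> tphi sg.
have tphi' := test_function_derive1 _ tphi.
have cphi := test_function_continuous _ tphi.
have cphi' := test_function_continuous _ tphi'.
have cg := smooth_upto_continuous 1 _ sg.
have cg' := smooth_upto_continuous 0 _ sg.2.
have lr f : smooth_upto 1 f -> derivable_oo_LRcontinuous f a b.
  move=> sf; have cf := smooth_upto_continuous 0 _ sf; split.
  - by move=> x _; exact: sf.1.
  - exact/cvg_at_right_filter/cf.
  - exact/cvg_at_left_filter/cf.
have itvE f : continuous f -> \int[mu]_(x in D) f x = \int[mu]_(x in `[a, b]) f x.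
  move=> cf; rewrite /Rintegral (@integral_itv_bndoo R a b (EFin \o f) true false)//.
  apply/measurable_EFinP; apply: (measurable_funS measurableT) => //.
  exact: continuous_measurable_fun.
rewrite !itvE; last 2 first.
- by move=> x; apply: cvgM; [exact: cphi|exact: cg'].
- by move=> x; apply: cvgM; [exact: cphi'|exact: cg].
rewrite (@Rintegration_by_parts R phi g (derive1 phi) (derive1 g) a b) ?opprB//.
- rewrite !(test_function_eq0 _ _ tphi) ?mul0r ?subrr ?addr0//.
  + by rewrite /= in_itv/= ltxx andbF.
  + by rewrite /= in_itv/= ltxx.
- exact: continuous_subspaceT.
- apply: lr; exact: test_function_smooth.
- exact: continuous_subspaceT.
- exact: lr (smooth_uptoW 1 _ sg).
Qed.

End interval.

(** * Smoothness of the convolution of a test function *)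

Section convol_smooth.
Context {R : realType}.
Local Notation mu := (@lebesgue_measure R).
Variables (a b : R) (k : R -> R) (e : R).
Hypothesis hab : a < b.
Hypothesis k_ge0 : forall t, 0 <= k t.
Hypothesis mk : measurable_fun setT k.
Hypothesis ik : mu.-integrable setT (EFin \o k).
Hypothesis he : e = 1 \/ e = -1.
Implicit Types phi : R -> R.

(** The substitution [y = x + e * t], where [e * e = 1], moves the dependence on [x] from the
    singular kernel to [phi], which can be differentiated. *)
Lemma convol_shift phi x : measurable_fun setT phi ->
  convol k e phi x = \int[mu]_t (k t * phi (x + e * t)).
Proof.
move=> mphi; rewrite /convol /Rintegral; congr fine.
rewrite -(integral_affine e x (fun y => (k (e * (y - x)) * phi y)%:E) he).
  apply: eq_integral => t _; rewrite addrC addKr mulrA.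
  by case: he => ->; rewrite ?mulr1 ?mul1r// mulrNN !mul1r.
apply/measurable_EFinP; apply: measurable_funM => //.
by apply: measurableT_comp => //; apply: measurable_funM => //; exact: measurable_funB.
Qed.

(** Differentiation under the integral in the shifted form, with the integrable majorant [C' * k],
    where [C'] bounds the derivative of [phi]. *)
Lemma is_derive_convol phi (x : R) : test_function a b phi ->
  is_derive x 1 (convol k e phi) (convol k e (derive1 phi) x).
Proof.
move=> tphi; have tphi' := test_function_derive1 _ _ _ tphi.
have mt psi : test_function a b psi -> measurable_fun setT psi.
  by move=> tpsi; apply: continuous_measurable_fun; exact: test_function_continuous tpsi.
have [C hC] := test_function_bounded _ _ hab _ tphi.
have [C' hC'] := test_function_bounded _ _ hab _ tphi'.
have C'0 : 0 <= C' by exact: le_trans (hC' 0).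
have -> : convol k e phi = (fun x => \int[mu]_t (k t * phi (x + e * t))).
  by apply/funext => z; apply: convol_shift; exact: mt.
rewrite convol_shift; last exact: mt.
pose f (z t : R) := k t * phi (z + e * t).
have df (z t : R) : is_derive z 1 (f ^~ t) (k t * derive1 phi (z + e * t)).
  have h1 : is_derive (z + e * t) 1 phi (derive1 phi (z + e * t)).
    by apply: (@smooth_upto_is_derive1 _ 0); exact: test_function_smooth tphi _.
  have h2 : is_derive z 1 (fun z : R => z + e * t) (1 : R).
    by apply: is_derive_eq; rewrite addr0.
  have h3 := @is_derive1_comp R phi (fun z : R => z + e * t) z _ _ h1 h2.
  have h4 := is_deriveZ (k t) h3.
  by apply: (@is_derive_eq _ _ _ _ _ _ _ _ h4); rewrite mulr1.
have mpt psi (z : R) : test_function a b psi -> measurable_fun setT (fun t => psi (z + e * t)).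
  by move=> tpsi; apply: (measurableT_comp (mt _ tpsi)); exact: measurable_affine.
have intf psi (B z : R) : test_function a b psi -> (forall t, `|psi t| <= B) ->
    mu.-integrable setT (EFin \o (fun t => k t * psi (z + e * t))).
  move=> tpsi hB.
  have B0 : 0 <= B by exact: le_trans (hB 0).
  apply: (le_integrable _ _ _ (integrableZl _ B ik)) => //.
    by apply/measurable_EFinP; apply: measurable_funM => //; exact: mpt.
  move=> t _; rewrite /= lee_fin normrM mulrC normrM ler_wpM2r//.
  by rewrite (le_trans (hB _))// ler_norm.
have d1f z t : partial1of2 f z t = k t * derive1 phi (z + e * t).
  by rewrite partial1of2E; case: (df z t).
have Ix : `]x - 1, x + 1[%classic x by rewrite /= in_itv/= ltrBlDr ltrDl ltr01.
have iG : mu.-integrable setT (EFin \o (fun t => C' * k t)).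
  by have := integrableZl (measurableT) C' ik; apply: eq_integrable.
have H1 : forall z, `]x - 1, x + 1[%classic z -> mu.-integrable setT (EFin \o f z).
  by move=> z _; exact: intf hC.
have H2 : forall z t : R, `]x - 1, x + 1[%classic z -> setT t -> derivable (f ^~ t) z 1.
  by move=> z t _ _; case: (df z t).
have H3 : forall t, 0 <= C' * k t by move=> t; exact: mulr_ge0.
have H4 : forall z t, `]x - 1, x + 1[%classic z -> setT t -> `|partial1of2 f z t| <= C' * k t.
  by move=> z t _ _; rewrite d1f normrM (ger0_norm (k_ge0 _)) mulrC ler_wpM2r.
split.
  exact: (@derivable_under_integral _ _ _ mu f setT measurableT x _ _ Ix H1 H2 (fun t => C' * k t) H3 iG H4).
rewrite -derive1E.
rewrite (@differentiation_under_integral _ _ _ mu f setT measurableT x _ _ Ix H1 H2 (fun t => C' * k t) H3 iG H4).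
by apply: eq_Rintegral => t _; exact: d1f.
Qed.

Lemma smooth_upto_convol n phi : test_function a b phi -> smooth_upto n (convol k e phi).
Proof.
elim: n phi => [//|n ih] phi tphi.
apply: (@smooth_upto_is_derive _ _ _ (convol k e (derive1 phi))).
  by move=> x; exact: is_derive_convol.
by apply: ih; exact: test_function_derive1.
Qed.

End convol_smooth.

(** * Integration by parts in the closure of the test functions *)

Section sobolev.
Context {R : realType}.
Local Notation mu := (@lebesgue_measure R).
Variables (a b p : R).
Hypotheses (hab : a < b) (hp : 1 <= p).
Local Notation D := (`]a, b[%classic : set R).
Implicit Types f g h u v w phi : R -> R.

Let p_neq0 : p != 0. Proof. by rewrite gt_eqF// (lt_le_trans _ hp). Qed.

Lemma normLp_powR f : (normLp a b p f `^ p = \int[mu]_x (`|(f \_ D) x| `^ p)%:E)%E.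
Proof.
by rewrite /normLp powR_Lnorm//; apply: eq_integral => x _; rewrite /= poweR_EFin.
Qed.

(** The weighted power inequality with weight the indicator of [D], of mass [b - a], followed by a
    [p]-th root. The constant is the [M + 1] of that inequality, larger than the one from
    Hoelder. *)
Lemma L1_le_normLp f : measurable_fun D f ->
  (\int[mu]_(x in D) `|f x|%:E <= (b - a + 1)%:E * normLp a b p f)%E.
Proof.
move=> mf; set X := integral _ _ _.
have p0 : 0 < p by exact: lt_le_trans hp.
have ba0 : 0 <= b - a by rewrite subr_ge0 ltW.
have ba1 : 0 <= b - a + 1 by rewrite addr_ge0.
have mfD : measurable_fun setT (fun x => `|(f \_ D) x|).
  by apply: measurableT_comp => //; apply/(measurable_restrictT (D := D)).
have N0 : (0 <= normLp a b p f)%E by exact: Lnorm_ge0.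
have XE : (X = \int[mu]_x (\1_D x * `|(f \_ D) x|)%:E)%E.
  rewrite /X integral_mkcond; apply: eq_integral => x _; rewrite !patchE indicE.
  by case: ifPn => //; rewrite ?mul1r ?mul0r.
have h : (X `^ p <= ((b - a + 1) `^ p)%:E * normLp a b p f `^ p)%E.
  rewrite XE normLp_powR.
  apply: le_trans (@poweR_weighted_integral_le _ _ _ mu p (b - a) (\1_D)
    (fun x => `|(f \_ D) x|) hp ba0 _ _ _ mfD _) _ => //.
  - apply: (@le_trans _ _ (mu D)); first by rewrite integral_indic// setIT.
    by rewrite lebesgue_measure_itv/= lte_fin hab -EFinB.
  - rewrite lee_wpmul2l ?lee_fin ?powR_ge0//.
    apply: ge0_le_integral => //.
    - apply/measurable_EFinP; apply: measurable_funM => //.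
      exact: (measurableT_comp (measurable_powR _) mfD).
    - apply/measurable_EFinP.
      exact: (measurableT_comp (measurable_powR _) mfD).
    by move=> x _; rewrite lee_fin ler_piMl ?powR_ge0.
have X0 : (0 <= X)%E by exact: integral_ge0.
have root Y : (0 <= Y)%E -> ((Y `^ p) `^ p^-1 = Y)%E.
  by move=> Y0; rewrite -poweRrM divff// poweRe1.
rewrite -(root X)// -(root (_ * _)%E) ?mule_ge0//.
apply: gt0_ler_poweR.
- by rewrite invr_ge0 ltW.
- by rewrite in_itv/= leey poweR_ge0.
- by rewrite in_itv/= leey poweR_ge0.
- by rewrite poweRM// poweR_EFin.
Qed.

Lemma Lp_space_measurable f : Lp_space a b p f -> measurable_fun D f.
Proof.
rewrite /Lp_space/= inE => /andP[/[!inE]/= mf _].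
exact/(measurable_restrictT (D := D)).
Qed.

Lemma normLp_lty_integrable f : measurable_fun D f -> (normLp a b p f < +oo)%E ->
  mu.-integrable D (EFin \o f).
Proof.
move=> mf fp; apply/integrableP; split; first exact/measurable_EFinP.
apply: le_lt_trans (L1_le_normLp f mf) _.
have ba1 : 0 <= b - a + 1 by rewrite addr_ge0// subr_ge0 ltW.
exact: lte_mul_pinfty.
Qed.

Lemma Lp_space_integrable f : Lp_space a b p f -> mu.-integrable D (EFin \o f).
Proof.
move=> fp; apply: normLp_lty_integrable; first exact: Lp_space_measurable.
by move: fp; rewrite /Lp_space/= inE => /andP[_]; rewrite inE.
Qed.

Lemma Lp_spaceP f : Lp_space a b p f <->
  measurable_fun D f /\ (\int[mu]_x (`|(f \_ D) x| `^ p)%:E < +oo)%E.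
Proof.
split=> [fp|[mf fp]].
  split; first exact: Lp_space_measurable.
  rewrite -normLp_powR poweR_lty//.
  by move: fp; rewrite /Lp_space/= inE => /andP[_]; rewrite inE.
rewrite /Lp_space/= inE; apply/andP; split; rewrite inE/=.
  exact/(measurable_restrictT (D := D)).
rewrite /finite_norm -/(normLp a b p f).
by apply: (@lty_poweRy _ _ p) => //; rewrite normLp_powR.
Qed.

Lemma integrable_Lp1 f : mu.-integrable D (EFin \o f) -> Lp_space a b 1 f.
Proof.
move=> fi; apply/Lfun1_integrable; rewrite -restrict_EFin.
exact/(@integrable_mkcond _ (measurableTypeR R) R mu D (EFin \o f) (measurable_itv _)).
Qed.

Lemma normW1p_ge f w : (normLp a b p f <= normW1p a b p f w)%E /\
  (normLp a b p w <= normW1p a b p f w)%E.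
Proof.
have root Y : (0 <= Y)%E -> ((Y `^ p) `^ p^-1 = Y)%E.
  by move=> Y0; rewrite -poweRrM divff// poweRe1.
have p0 : 0 <= p^-1 by rewrite invr_ge0 (le_trans _ hp).
have N0 g : (0 <= normLp a b p g)%E by exact: Lnorm_ge0.
rewrite /normW1p; split.
  rewrite -{1}(root (normLp a b p f))//; apply: gt0_ler_poweR => //.
  - by rewrite in_itv/= leey poweR_ge0.
  - by rewrite in_itv/= leey adde_ge0 ?poweR_ge0.
  - by rewrite leeDl// poweR_ge0.
rewrite -{1}(root (normLp a b p w))//; apply: gt0_ler_poweR => //.
- by rewrite in_itv/= leey poweR_ge0.
- by rewrite in_itv/= leey adde_ge0 ?poweR_ge0.
- by rewrite leeDr// poweR_ge0.
Qed.

Lemma le_normr_integral_mul f g (C e : R) : mu.-integrable D (EFin \o f) ->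
  continuous g -> (forall x, D x -> `|g x| <= C) -> (normLp a b p f <= e%:E)%E ->
  `|\int[mu]_(x in D) (f x * g x)| <= C * ((b - a + 1) * e).
Proof.
move=> fi cg gC fe.
have mf : measurable_fun D f by move/integrableP : fi => [/measurable_EFinP].
have ifg := integrableM_continuous a b hab f g fi cg.
(* The bound is evaluated at the midpoint, which lies in [D] since [a < b]. *)
have C0 : 0 <= C.
  by apply: (le_trans (normr_ge0 (g ((a + b) / 2)))); apply: gC; rewrite /= in_itv/= !midf_lt.
have ba1 : 0 <= b - a + 1 by rewrite addr_ge0// subr_ge0 ltW.
apply: le_trans; first exact: le_normr_Rintegral.
apply: (@le_trans _ _ (\int[mu]_(x in D) (C * `|f x|))).
  apply: le_Rintegral => //.
  - exact: integrable_norm.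
  - have := integrableM_continuous a b hab (fun x => `|f x|) (cst C) (integrable_norm fi) (@cst_continuous _ _ C).
    by apply: eq_integrable => // x _; rewrite /= mulrC.
  - by move=> x Dx; rewrite normrM mulrC ler_wpM2r// gC.
rewrite RintegralZl//; last exact: integrable_norm.
rewrite ler_wpM2l// -lee_fin.
have := L1_le_normLp f mf.
have -> : (\int[mu]_(x in D) `|f x|%:E = (\int[mu]_(x in D) `|f x|)%:E)%E.
  by rewrite /Rintegral fineK//; apply: integrable_fin_num => //; exact: (integrable_norm fi).
move=> /le_trans; apply.
by rewrite EFinM lee_wpmul2l.
Qed.

(** For a test function [phi] close to [u], integration by parts is exact. What remains is the
    pairing of [u - phi] and of its weak derivative with smooth functions bounded on [D], which is
    of the order of the distance. *)
Lemma W01p_integral_by_parts u v g : W01p a b p u -> Lp_space a b p v ->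
  is_weak_derivative a b u v -> (forall n, smooth_upto n g) ->
  \int[mu]_(x in D) (v x * g x) = - \int[mu]_(x in D) (u x * derive1 g x).
Proof.
move=> [[uLp _] uW] vLp uv sg.
have ui := Lp_space_integrable _ uLp.
have vi := Lp_space_integrable _ vLp.
have cg := smooth_upto_continuous 0 g (sg 1%N).
have cg' := smooth_upto_continuous 0 (derive1 g) (sg 2%N).2.
have [C gC] := continuous_bounded_itv a b hab g cg.
have [C' gC'] := continuous_bounded_itv a b hab (derive1 g) cg'.
apply/eqP; rewrite -addr_eq0; apply/eqP.
set X := \int[mu]_(x in D) (v x * g x) + _.
suff main (e : R) : 0 < e -> `|X| <= (C * (b - a + 1) + C' * (b - a + 1)) * e.
  apply/normr0_eq0/eqP; rewrite eq_le normr_ge0 andbT.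
  set K := C * (b - a + 1) + C' * (b - a + 1) in main.
  apply/ler_addgt0Pr => e e0; rewrite add0r.
  (* This divisor is positive and dominates [K], even when [K] vanishes. *)
  have K1 : 0 < `|K| + 1 by rewrite ltr_wpDl.
  apply: (le_trans (main (e / (`|K| + 1)) (divr_gt0 e0 K1))).
  rewrite mulrCA ler_piMr ?(ltW e0)// ler_pdivrMr// mul1r.
  by rewrite (le_trans (ler_norm _))// lerDl.
move=> e0; have [phi [w [tphi [_ [mw _ _] hw] nW]]] := uW e e0.
have [N1 N2] := normW1p_ge (u \- phi)%R w.
have cphi := test_function_continuous a b phi tphi.
have tphi' := test_function_derive1 a b phi tphi.
have cphi' := test_function_continuous a b _ tphi'.
have ci f : continuous f -> mu.-integrable D (EFin \o f).
  move=> cf; apply: (@integrableS _ (measurableTypeR R) R mu `[a, b]) => //.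
    exact: subset_itv_oo_cc.
  apply: continuous_compact_integrable; first exact: segment_compact.
  exact: continuous_subspaceT.
(* As a weak derivative [w] is only locally integrable; its finite norm gives integrability on all
   of [D]. *)
have wi : mu.-integrable D (EFin \o w).
  by apply: normLp_lty_integrable => //; rewrite (le_lt_trans N2)// (lt_trans nW)// ltry.
have iM := integrableM_continuous a b hab.
have iB f1 f2 : mu.-integrable D (EFin \o f1) -> mu.-integrable D (EFin \o f2) ->
    mu.-integrable D (EFin \o (fun x => f1 x - f2 x)).
  move=> h1 h2; have mD : measurable (D : set (measurableTypeR R)) by exact: measurable_itv.
  by apply: (eq_integrable mD _ _ _ (integrableB mD h1 h2)) => x _.
have iBM f1 f2 h : mu.-integrable D (EFin \o f1) -> mu.-integrable D (EFin \o f2) ->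
    continuous h -> \int[mu]_(x in D) ((f1 x - f2 x) * h x) =
    \int[mu]_(x in D) (f1 x * h x) - \int[mu]_(x in D) (f2 x * h x).
  move=> h1 h2 ch; rewrite -RintegralB//; [|exact: iM|exact: iM].
  by apply: eq_Rintegral => x _; rewrite mulrBl.
have uphi := iB _ _ ui (ci _ cphi).
have vphi := iB _ _ vi (ci _ cphi').
(* Both [w] and [v - derive1 phi] are weak derivatives of [u - phi], so their difference annihilates
   every test function, hence also [g]. *)
have Z : \int[mu]_(x in D) ((v x - derive1 phi x - w x) * g x) = 0.
  apply: (integral_smooth_eq0 a b hab (fun x => v x - derive1 phi x - w x)) => //.
    exact: iB.
  move=> psi tpsi.
  have cpsi := test_function_continuous a b psi tpsi.
  have cpsi' := test_function_continuous a b _ (test_function_derive1 a b psi tpsi).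
  rewrite (iBM (fun x => v x - derive1 phi x) w psi)// iBM//; last exact: ci.
  case: uv => _ _ ->//; rewrite hw//.
  rewrite (integral_by_parts_test a b hab)//; last exact: test_function_smooth tpsi _.
  rewrite (iBM u phi)//; last exact: ci.
  by rewrite !opprK; ring.
rewrite (iBM (fun x => v x - derive1 phi x) w g)// iBM// in Z; last exact: ci.
rewrite (integral_by_parts_test a b hab)// in Z.
have Y := iBM u phi (derive1 g) ui (ci _ cphi) cg'.
(* The terms in [phi] cancel by classical integration by parts, leaving two small integrals. *)
have XE : X = \int[mu]_(x in D) (w x * g x) +
    \int[mu]_(x in D) ((u x - phi x) * derive1 g x).
  by rewrite Y /X; lra.
rewrite XE (le_trans (ler_normD _ _))// mulrDl lerD//.
  rewrite -mulrA; apply: le_normr_integral_mul => //.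
  exact/ltW/(le_lt_trans N2).
rewrite -mulrA; apply: le_normr_integral_mul => //.
exact/ltW/(le_lt_trans N1).
Qed.

End sobolev.

(** * Fractional integrals *)

Section fractional.
Context {R : realType}.
Local Notation mu := (@lebesgue_measure R).
Variables (a b alpha p : R).
Hypotheses (hab : a < b) (halpha1 : alpha < 1) (hp : 1 <= p).
Local Notation D := (`]a, b[%classic : set R).
Local Notation k := (riesz_kernel alpha (b - a)).
Implicit Types f g h u v w phi : R -> R.

(** The support of the kernel imposes [y < x], and the zero extension of [f] imposes [a < y]. The
    truncation is then harmless, since [x - y < b - a] follows from [a < y] and [x < b]. *)
Lemma fracI_leftE f x : D x ->
  fracI_left a (1 - alpha) f x = (Gamma (1 - alpha))^-1 * convol k (-1) (f \_ D) x.
Proof.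
rewrite /= in_itv/= => /andP[ax xb]; rewrite /fracI_left; congr (_ * _).
rewrite Rintegral_mkcond; apply: eq_Rintegral => y _.
rewrite /riesz_kernel !patchE !mem_setE !in_itv/= mulN1r [- (y - x)]opprB subKr.
have [yx|xy] := ltP y x; last first.
  by rewrite andbF subr_gt0 ltNge xy/= mul0r.
rewrite andbT subr_gt0 yx (lt_trans yx xb) andbT.
have [ay|ya] := ltP a y; last by rewrite mulr0.
rewrite mulrC ifT//; lra.
Qed.

Lemma fracI_rightE f x : D x ->
  fracI_right b (1 - alpha) f x = (Gamma (1 - alpha))^-1 * convol k 1 (f \_ D) x.
Proof.
rewrite /= in_itv/= => /andP[ax xb]; rewrite /fracI_right; congr (_ * _).
rewrite Rintegral_mkcond; apply: eq_Rintegral => y _.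
rewrite /riesz_kernel !patchE !mem_setE !in_itv/= mul1r subKr.
have [xy|yx] := ltP x y; last first.
  by rewrite /= subr_gt0 [x < y]ltNge yx/= mul0r.
rewrite subr_gt0 xy (lt_trans ax xy)/=.
have [yb|by_] := ltP y b; last by rewrite mulr0.
rewrite mulrC ifT//; lra.
Qed.

Let kpos := @riesz_kernel_ge0 R alpha (b - a).
Let kmeas := @measurable_riesz_kernel R alpha (b - a).
Let kint := @integrable_riesz_kernel R alpha (b - a) halpha1.

Lemma test_function_restrict phi : test_function a b phi -> phi \_ D = phi.
Proof.
move=> tphi; apply/funext => x; rewrite patchE; case: ifPn => // /negP Dx.
by rewrite (test_function_eq0 a b phi x tphi)// => /mem_set.
Qed.

(** The formula for [f] is available only on [D], but [D] is open, so it holds near [x] and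
    determines the derivative. *)
Lemma derive1_on (c e : R) phi f x : D x -> test_function a b phi ->
  e = 1 \/ e = -1 ->
  (forall y, D y -> f y = c * convol k e phi y) ->
  derive1 f x = c * derive1 (convol k e phi) x.
Proof.
move=> Dx tphi he fE.
have dG := is_derive_convol a b k e hab kpos kmeas kint he phi x tphi.
have h : is_derive x 1 (fun y => c * convol k e phi y) (c * convol k e (derive1 phi) x).
  exact: is_deriveZ.
have h' : is_derive x 1 f (c * convol k e (derive1 phi) x).
  apply: near_eq_is_derive h.
  have : nbhs x D by apply: open_nbhs_nbhs; split => //; exact: itv_open.
  by apply: filterS => y Dy; rewrite fE.
by rewrite !derive1E; case: h' => _ ->; case: dG => _ ->.
Qed.

(** * The weak fractional derivative by duality, for both signs at once *)

Section duality.
Variables (e c : R) (u v v' : R -> R).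
Hypothesis he : e = 1 \/ e = -1.
Hypothesis uW : W01p a b p u.
Hypothesis vLp : Lp_space a b p v.
Hypothesis uv : is_weak_derivative a b u v.
Hypothesis v'E : forall x, D x -> v' x = c * convol k e (v \_ D) x.

Let he' : - e = 1 \/ - e = -1.
Proof. by case: he => ->; rewrite ?opprK; [right|left]. Qed.

Let vi : mu.-integrable setT (EFin \o (v \_ D)).
Proof.
rewrite -restrict_EFin.
apply/(@integrable_mkcond _ (measurableTypeR R) R mu D (EFin \o v) (measurable_itv _)).
exact: Lp_space_integrable vLp.
Qed.

(** Young's inequality for the zero extension of [v]; the constant contributes the factor
    [|c|^p]. *)
Lemma Lp_space_fractional : Lp_space a b p v'.
Proof.
have mc : measurable_fun setT (convol k e (v \_ D)).
  exact: (measurable_convol k kpos kmeas kint e (v \_ D) he vi).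
have p0 : 0 <= p by exact: le_trans hp.
have [mv vp] := (Lp_spaceP a b p hp v).1 vLp.
apply/(Lp_spaceP a b p hp); split.
  apply: (eq_measurable_fun (fun x => c * convol k e (v \_ D) x)).
    by move=> x /set_mem Dx; rewrite v'E.
  by apply: measurable_funM => //; exact: measurable_funTS.
have mcp : measurable_fun setT (fun x => `|convol k e (v \_ D) x| `^ p).
  apply: (measurableT_comp (measurable_powR _)); exact: measurableT_comp.
have mv' : measurable_fun setT (v' \_ D).
  apply/(measurable_restrictT (D := D)) => //.
  apply: (eq_measurable_fun (fun x => c * convol k e (v \_ D) x)).
    by move=> x /set_mem Dx; rewrite v'E.
  by apply: measurable_funM => //; exact: measurable_funTS.
apply: (@le_lt_trans _ _ (\int[mu]_x (`|c| `^ p * `|convol k e (v \_ D) x| `^ p)%:E)%E).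
  apply: ge0_le_integral => //.
  - apply/measurable_EFinP; apply: (measurableT_comp (measurable_powR _)).
    exact: measurableT_comp.
  - by apply/measurable_EFinP; exact: measurable_funM.
  move=> x _; rewrite lee_fin -powRM// -normrM patchE; case: ifPn => [/set_mem Dx|_].
    by rewrite v'E.
  rewrite normr0; apply: ge0_ler_powR => //; by rewrite nnegrE.
under eq_integral do rewrite EFinM.
rewrite ge0_integralZl_EFin ?powR_ge0//.
- rewrite lte_mul_pinfty ?lee_fin ?powR_ge0//.
  exact: (convol_powR_lty k kpos kmeas kint e _ he vi p hp vp).
- exact/measurable_EFinP.
Qed.

(** The convolution is first transposed onto [phi], giving a smooth function of the opposite side;
    the derivative is then moved from [u] onto it, and this is the source of the minus sign in
    [psi]. *)
Lemma integral_fractional phi psi : test_function a b phi ->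
  (forall x, D x -> psi x = - (c * derive1 (convol k (- e) phi) x)) ->
  \int[mu]_(x in D) (v' x * phi x) = \int[mu]_(x in D) (u x * psi x).
Proof.
move=> tphi psiE.
have [C hC] := test_function_bounded a b hab phi tphi.
have cphi := test_function_continuous a b phi tphi.
have mphi : measurable_fun setT phi by exact: continuous_measurable_fun.
have sG n := smooth_upto_convol a b k (- e) hab kpos kmeas kint he' n phi tphi.
have cG' := smooth_upto_continuous 0 _ (sG 2%N).2.
have ui := Lp_space_integrable a b p hab hp u uW.1.1.
have ci := integrable_convol k kpos kmeas kint e (v \_ D) he vi.
have iD : mu.-integrable D (EFin \o convol k e (v \_ D)).
  by apply: (@integrableS _ (measurableTypeR R) R mu setT) => //; exact: measurable_itv.
transitivity (c * \int[mu]_(x in D) (convol k e (v \_ D) x * phi x)).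
  rewrite -RintegralZl//; last exact: integrableM_continuous.
  by apply: eq_Rintegral => x /set_mem Dx; rewrite v'E// mulrA.
transitivity (- c * \int[mu]_(x in D) (u x * derive1 (convol k (- e) phi) x)); last first.
  rewrite -RintegralZl//; last exact: integrableM_continuous.
  by apply: eq_Rintegral => x /set_mem Dx; rewrite psiE//; ring.
rewrite mulNr -mulrN; congr (_ * _).
rewrite -(W01p_integral_by_parts a b p hab hp u v _ uW vLp uv)//.
have H := integral_convol_mul k kpos kmeas kint e (v \_ D) he vi phi C mphi hC.
(* Transposition is stated on the whole line: [phi] already vanishes off [D], and on the other side
   the restriction is absorbed into the zero extension of [v]. *)
rewrite [LHS]Rintegral_mkcond [RHS]Rintegral_mkcond.
rewrite (_ : (fun x => convol k e (v \_ D) x * phi x) \_ D =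
  fun x => convol k e (v \_ D) x * phi x); last first.
  apply/funext => x; rewrite patchE -{2}(test_function_restrict _ tphi) patchE.
  by case: ifPn; rewrite ?mulr0.
rewrite H; apply: eq_Rintegral => x _; rewrite !patchE.
by case: ifPn; rewrite ?mul0r.
Qed.

End duality.

(** * The left and right inclusions *)

(** The duality is applied with [e = -1] and [c = 1 / Gamma (1 - alpha)]; the candidate is the left
    Caputo derivative of [u]. The minus sign from integration by parts is the one built into
    [fracD_right]. *)
Lemma W01p_subset_W_left : W01p a b p `<=` W_left a b alpha p.
Proof.
move=> u uW; have [[uLp [v uv vLp]] _] := uW.
pose v' x := fracI_left a (1 - alpha) v x.
have v'E x : D x -> v' x = (Gamma (1 - alpha))^-1 * convol k (-1) (v \_ D) x.
  exact: fracI_leftE.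
have v'Lp := Lp_space_fractional (-1) _ v v' (or_intror erefl) vLp v'E.
split => //; exists v' => //; split.
- exact/integrable_Lp1/(Lp_space_integrable a b p hab hp).
- by apply: open_integrable_locally; [exact: itv_open|exact: (Lp_space_integrable a b p hab hp)].
- move=> phi tphi.
  apply: (integral_fractional (-1) _ u v v' (or_intror erefl) uW vLp uv v'E) => // x Dx.
  rewrite opprK /fracD_right; congr (- _).
  apply: derive1_on => //; first by left.
  by move=> y Dy; rewrite fracI_rightE// test_function_restrict.
Qed.

(** Now [e = 1], and the sign goes into the candidate, [c = - 1 / Gamma (1 - alpha)]. It cancels the
    minus sign from integration by parts, in accordance with [fracD_left], which carries none. *)
Lemma W01p_subset_W_right : W01p a b p `<=` W_right a b alpha p.
Proof.
move=> u uW; have [[uLp [v uv vLp]] _] := uW.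
pose v' x := - fracI_right b (1 - alpha) v x.
have v'E x : D x -> v' x = - (Gamma (1 - alpha))^-1 * convol k 1 (v \_ D) x.
  by move=> Dx; rewrite mulNr -fracI_rightE.
have v'Lp := Lp_space_fractional 1 _ v v' (or_introl erefl) vLp v'E.
split => //; exists v' => //; split.
- exact/integrable_Lp1/(Lp_space_integrable a b p hab hp).
- by apply: open_integrable_locally; [exact: itv_open|exact: (Lp_space_integrable a b p hab hp)].
- move=> phi tphi.
  apply: (integral_fractional 1 _ u v v' (or_introl erefl) uW vLp uv v'E) => // x Dx.
  rewrite mulNr opprK /fracD_left.
  apply: derive1_on => //; first by right.
  by move=> y Dy; rewrite fracI_leftE// test_function_restrict.
Qed.

End fractional.

Theorem theorem5p15 (R : realType) (a b alpha p : R)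
    (hab : a < b) (halpha0 : 0 < alpha) (halpha1 : alpha < 1) (hp : 1 <= p) :
  [/\ W01p a b p `<=` W_left a b alpha p,
      W01p a b p `<=` W_right a b alpha p &
      W01p a b p `<=` W_frac a b alpha p].
Proof.
have hl := W01p_subset_W_left a b alpha p hab halpha1 hp.
have hr := W01p_subset_W_right a b alpha p hab halpha1 hp.
by split=> // u uW; split; [exact: hl|exact: hr].
Qed.
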